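(* Let $\mathcal{A}$ be a randomized online coloring algorithm that does not use the disk representation. For every $n\in\mathbb{N}$ and $\rho\in\mathbb{R}$ with $\min\{n,\rho\}\geq 25$, there exists an $n$-vertex disk graph $G$ with $\chi(G)=2$, presented by an oblivious adversary, realized by disks in which the ratio of the largest to the smallest disk radius is $\rho$, such that the expected number of colors used by $\mathcal{A}$ is $\Omega(\min\{\log n,\log\rho\})$, with an absolute implicit constant.
   Context: A disk graph is the intersection graph of a finite set of closed disks in the Euclidean plane: vertices correspond to disks and two vertices are adjacent iff their disks intersect. Online graph coloring: the vertices arrive one at a time in an order chosen by an adversary; when a vertex arrives, its edges to previously presented vertices are revealed (but not the disk itself, which the algorithm does not see/use), and the algorithm must immediately and irrevocably assign it a color different from the colors of its already-presented neighbors. An oblivious adversary fixes the graph, its disk realization and the presentation order in advance, without knowledge of the algorithm's random choices. The cost is the expected number of distinct colors used. *)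

(* Defs.v *)
From mathcomp Require Import all_boot all_order all_algebra.
From mathcomp Require Import all_classical all_reals all_analysis.

Set Implicit Arguments.
Unset Strict Implicit.
Unset Printing Implicit Defensive.

Import Order.TTheory GRing.Theory Num.Theory.
Import numFieldNormedType.Exports.

Local Open Scope classical_set_scope.
Local Open Scope ring_scope.

Record disk (R : realType) := Disk {
  center : R * R;
  radius : R;
  radius_gt0 : 0 < radius }.

(* The library norm on [R * R] is the sup norm, hence the explicit Euclidean
   formula. *)
Definition disk_set (R : realType) (D : disk R) : set (R * R) :=
  [set p | (p.1 - (center D).1) ^+ 2 + (p.2 - (center D).2) ^+ 2
             <= radius D ^+ 2].

(* Injectivity: a disk graph comes from a set of disks, not a multiset. *)
Definition realizes (R : realType) (n : nat) (D : 'I_n -> disk R)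
    (G : rel 'I_n) : Prop :=
  injective (fun i => disk_set (D i)) /\
  (forall i j, G i j <-> i <> j /\ disk_set (D i) `&` disk_set (D j) !=set0).

Definition disk_graph (R : realType) (n : nat) (G : rel 'I_n) : Prop :=
  exists D : 'I_n -> disk R, realizes D G.

Definition radius_ratio (R : realType) (n : nat) (D : 'I_n -> disk R)
    (rho : R) : Prop :=
  exists i j, (forall k, radius (D j) <= radius (D k) <= radius (D i)) /\
              radius (D i) / radius (D j) = rho.

Definition proper_coloring (T : Type) (C : eqType) (G : rel T) (f : T -> C) :=
  forall x y, G x y -> f x != f y.

Definition colorable (T : finType) (G : rel T) (k : nat) : bool :=
  `[< exists f : T -> 'I_k, proper_coloring G f >].

(* A loopless graph is always [#|T|]-colorable, so the minimum over
   [k <= #|T|] is its chromatic number. *)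
Definition chromatic_number (T : finType) (G : rel T) : nat :=
  [arg min_(k < ord_max : 'I_#|T|.+1 | colorable G k) k]%N.

(* A deterministic online strategy. Vertices are numbered in order of arrival;
   the color of vertex [k] is a function of the graph induced on the vertices
   [0, ..., k]. The earlier colors are determined by the same data, so they
   need not be an argument. *)
Definition strategy := forall k : nat, rel 'I_k.+1 -> nat.

Definition revealed (n : nat) (G : rel 'I_n) (k : 'I_n) : rel 'I_k.+1 :=
  relpre (widen_ord (ltn_ord k)) G.
Arguments revealed {n} G k _ _.

Definition run (A : strategy) (n : nat) (G : rel 'I_n) : 'I_n -> nat :=
  fun k => A k (revealed G k).

Definition online_coloring (R : realType) (A : strategy) : Prop :=
  forall (n : nat) (G : rel 'I_n), disk_graph R G -> proper_coloring G (run A G).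

(* A randomized algorithm is a random deterministic one; [T] is the space of
   its random choices. *)
Definition randomized_online_coloring (R : realType) (d : measure_display)
    (T : measurableType d) (A : T -> strategy) : Prop :=
  (forall w, online_coloring R (A w)) /\
  (forall k (H : rel 'I_k.+1), measurable_fun [set: T] (fun w => A w k H)).

Definition num_colors (n : nat) (f : 'I_n -> nat) : nat :=
  size (undup (codom f)).

(* Main.v *)
Require Import Defs.
From mathcomp Require Import all_boot all_order all_algebra.
From mathcomp Require Import all_classical all_reals all_analysis.
From mathcomp Require Import measurable_realfun ring lra zify.

(** By Yao's principle it suffices to exhibit a finite distribution on forests
    that is hard for every deterministic algorithm.  A gadget of level [k+1]
    consists of two independent gadgets of level [k] followed by one new vertex;
    a fair coin decides whether the new vertex is isolated or is joined to all
    the roots of the first gadget, which then stop being roots.  Whatever the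
    algorithm does, the expected number of colors on the roots grows by at least
    1/4 per level: if the two gadgets show different color sets on their roots,
    the union gains on the average, and if they show the same set, the joined
    vertex needs a color outside it.  A gadget of level [k] has [2^(k+1) - 1]
    vertices.

    For the realization, the vertex joining a gadget of level [k] is a disk of
    radius [4^k] as wide as the gadget below it, whose roots hang from its lower
    boundary, each one tangent to it.  Unrelated subtrees lie in disjoint
    vertical strips, and the descendants of a root stay below its center, too
    low for its parent to reach them. *)

Set Implicit Arguments.
Unset Strict Implicit.
Unset Printing Implicit Defensive.

Import Order.TTheory GRing.Theory Num.Theory.
Import numFieldNormedType.Exports.

Local Open Scope classical_set_scope.
Local Open Scope ring_scope.

(** * The random forest *)

(* The boolean is the coin: [true] joins the new vertex to the first copy. *)
Fixpoint seed (k : nat) : finType :=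
  if k is k'.+1 then (seed k' * seed k' * bool)%type else unit.

(* [None] is the new vertex, presented after both copies. *)
Fixpoint vertex (k : nat) : eqType :=
  if k is k'.+1 then option (vertex k' + vertex k') else unit.

Notation fst_copy u := (Some (inl u)).
Notation snd_copy u := (Some (inr u)).

Fixpoint forest_roots (k : nat) : seed k -> seq (vertex k) :=
  match k with
  | 0 => fun _ => [:: tt]
  | k'.+1 => fun s : seed k' * seed k' * bool =>
      let: (s1, s2, b) := s in
      None :: (if b then [::] else [seq fst_copy u | u <- forest_roots s1])
           ++ [seq snd_copy u | u <- forest_roots s2]
  end.

Fixpoint adj (k : nat) : seed k -> rel (vertex k) :=
  match k with
  | 0 => fun _ _ _ => false
  | k'.+1 => fun (s : seed k' * seed k' * bool)
                 (u v : option (vertex k' + vertex k')) =>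
      let: (s1, s2, b) := s in
      match u, v with
      | fst_copy u', fst_copy v' => adj s1 u' v'
      | snd_copy u', snd_copy v' => adj s2 u' v'
      | None, fst_copy v' => b && (v' \in forest_roots s1)
      | fst_copy u', None => b && (u' \in forest_roots s1)
      | _, _ => false
      end
  end.

Fixpoint num_vertices (k : nat) : nat :=
  if k is k'.+1 then (num_vertices k' + num_vertices k').+1 else 1.

Fixpoint rank (k : nat) : vertex k -> nat :=
  match k with
  | 0 => fun _ => 0%N
  | k'.+1 => fun u : option (vertex k' + vertex k') =>
      match u with
      | fst_copy u' => rank u'
      | snd_copy u' => (num_vertices k' + rank u')%N
      | None => (num_vertices k' + num_vertices k')%N
      end
  end.

Fixpoint unrank (k : nat) : nat -> vertex k :=
  match k with
  | 0 => fun _ => tt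
  | k'.+1 => fun i =>
      if (i < num_vertices k')%N then fst_copy (unrank k' i)
      else if (i < num_vertices k' + num_vertices k')%N
      then snd_copy (unrank k' (i - num_vertices k'))
      else None
  end.

Lemma num_verticesE k : (num_vertices k).+1 = (2 ^ k.+1)%N.
Proof. by elim: k => //= k IH; rewrite expnS -IH; lia. Qed.

Lemma rank_lt k (u : vertex k) : (rank u < num_vertices k)%N.
Proof.
elim: k u => [|k IH] //= [[u|u]|] /=; last by lia.
- by have := IH u; lia.
- by have := IH u; lia.
Qed.

Lemma rankK k : cancel (@rank k) (unrank k).
Proof.
elim: k => [|k IH] /=; first by case.
case=> [[u|u]|].
- by rewrite rank_lt IH.
- by rewrite ltnNge leq_addr /= ltn_add2l rank_lt addKn IH.
- by rewrite ltnNge leq_addr /= ltnn.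
Qed.

Lemma unrankK k i : (i < num_vertices k)%N -> rank (unrank k i) = i.
Proof.
elim: k i => [|k IH] i /=; first by case: i.
move=> lt_i; case: ifP => [/IH //|/negbT]; rewrite -leqNgt => le_i.
by case: ifP => h; [rewrite IH; lia | move/negbT: h; lia].
Qed.

Lemma forest_roots_fst k (s1 s2 : seed k) b u :
  (fst_copy u \in forest_roots ((s1, s2, b) : seed k.+1)) = ~~ b && (u \in forest_roots s1).
Proof.
rewrite /= in_cons /= mem_cat.
have -> : (fst_copy u \in [seq (snd_copy v : vertex k.+1) | v <- forest_roots s2]) = false.
  by apply/negbTE/negP => /mapP [].
rewrite orbF; case: b => //=.
by rewrite mem_map // => x y [].
Qed.

Lemma forest_roots_snd k (s1 s2 : seed k) b u :
  (snd_copy u \in forest_roots ((s1, s2, b) : seed k.+1)) = (u \in forest_roots s2).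
Proof.
rewrite /= in_cons /= mem_cat.
have -> : (snd_copy u \in if b then [::] else
    [seq (fst_copy v : vertex k.+1) | v <- forest_roots s1]) = false.
  by case: b => //; apply/negbTE/negP => /mapP [].
by rewrite /= mem_map // => x y [].
Qed.

Lemma adj_irr k (s : seed k) : irreflexive (adj s).
Proof. by elim: k s => [|k IH] //= [[s1 s2] b] [[u|u]|] //=; exact: IH. Qed.

(* Normalized so that roots are on the side [false]; joining the first copy
   therefore flips it. *)
Fixpoint side (k : nat) : seed k -> vertex k -> bool :=
  match k with
  | 0 => fun _ _ => false
  | k'.+1 => fun (s : seed k' * seed k' * bool) (u : option (vertex k' + vertex k')) =>
      let: (s1, s2, b) := s in
      match u with
      | fst_copy u' => b (+) side s1 u'
      | snd_copy u' => side s2 u'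
      | None => false
      end
  end.

Lemma side_roots k (s : seed k) u : u \in forest_roots s -> side s u = false.
Proof.
elim: k s u => [|k IH] // [[s1 s2] b] [[u|u]|] //.
- by rewrite forest_roots_fst => /andP [/negbTE -> /IH /= ->].
- by rewrite forest_roots_snd => /IH.
Qed.

Lemma side_adj k (s : seed k) : proper_coloring (adj s) (side s).
Proof.
elim: k s => [|k IH] // [[s1 s2] b] [[u|u]|] [[v|v]|] //=.
- by move/IH; rewrite (can_eq (addKb b)).
- by move=> /andP [-> /side_roots ->].
- by move/IH.
- by move=> /andP [-> /side_roots ->].
Qed.

(** * Counting the colors on the roots *)

Definition ndistinct (l : seq nat) : nat := size (undup l).

Lemma ndistinct_subset l1 l2 : {subset l1 <= l2} -> (ndistinct l1 <= ndistinct l2)%N.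
Proof.
move=> sub; apply: uniq_leq_size; first exact: undup_uniq.
by move=> x; rewrite !mem_undup; apply: sub.
Qed.

Lemma ndistinct_cons x l : x \notin l -> ndistinct (x :: l) = (ndistinct l).+1.
Proof. by rewrite /ndistinct /= => /negbTE ->. Qed.

(* When the two color sets differ, leaving the new vertex isolated gains a
   color; when they coincide, joining it to the first copy does. *)
Lemma ndistinct_coin l1 l2 x y : x \notin l1 ->
  (ndistinct l1 + 3 * ndistinct l2 + 1 <=
   2 * (ndistinct (y :: l1 ++ l2) + ndistinct (x :: l2)))%N.
Proof.
move=> xl1.
have h1 : (ndistinct l1 <= ndistinct (y :: l1 ++ l2))%N.
  by apply: ndistinct_subset => z zl; rewrite inE mem_cat zl orbT.
have h2 : (ndistinct l2 <= ndistinct (y :: l1 ++ l2))%N.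
  by apply: ndistinct_subset => z zl; rewrite inE mem_cat zl !orbT.
have t : (ndistinct l2 <= ndistinct (x :: l2))%N.
  by apply: ndistinct_subset => z zl; rewrite inE zl orbT.
(* Unequal counts suffice: both counts on the right are at least [ndistinct l2], and one is at least
   the larger of the two. With equal counts, one extra color in either term is enough. *)
have [eq12|] := eqVneq (ndistinct l1) (ndistinct l2); last by lia.
have [/allP sub|/allPn [z zl1 zl2]] := boolP (all (mem l2) l1).
  have [_ eqm] : (size (undup l1) = size (undup l2)) * (undup l1 =i undup l2).
    apply: uniq_min_size; first exact: undup_uniq.
      by move=> z; rewrite !mem_undup; apply: sub.
    by rewrite -/(ndistinct l1) eq12.
  have xl2 : x \notin l2 by rewrite -mem_undup -eqm mem_undup.
  by have := ndistinct_cons xl2; lia.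
have : (ndistinct (z :: l2) <= ndistinct (y :: l1 ++ l2))%N.
  apply: ndistinct_subset => t'; rewrite !inE mem_cat.
  by case/predU1P => [->|->]; rewrite ?zl1 !orbT.
by rewrite (ndistinct_cons zl2); lia.
Qed.

(* [f s v] may depend on the graph only up to the arrival of [v]. *)
Definition causal k (f : seed k -> vertex k -> nat) : Prop :=
  forall s s' v,
    (forall u u', (rank u <= rank v)%N -> (rank u' <= rank v)%N ->
       adj s u u' = adj s' u u') ->
    f s v = f s' v.

Definition root_colors k (f : seed k -> vertex k -> nat) (s : seed k) : nat :=
  ndistinct [seq f s v | v <- forest_roots s].

Definition seed0 k : seed k.
Proof. by elim: k => [|k s]; [exact: tt | exact: (s, s, false)]. Defined.

Lemma card_seedS k : #|seed k.+1| = (2 * #|seed k| ^ 2)%N.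
Proof. by rewrite /= !card_prod card_bool mulnC mulnn. Qed.

(** In division-free form, the mean of [root_colors] is at least [1 + k/4]. Induction applies to the
    first copy and, for each fixed [s1], to the second: having seen the first copy, the strategy on
    the second is still deterministic and causal. *)
Lemma sum_root_colors k (f : seed k -> vertex k -> nat) :
  causal f -> (forall s, proper_coloring (adj s) (f s)) ->
  (#|seed k| * (k + 4) <= 4 * \sum_s root_colors f s)%N.
Proof.
elim: k f => [|k IH] f cf pf.
  by rewrite (eq_bigr (fun=> 1%N)) // sum1_card add0n mulnC.
(* The copies arrive one after the other and the new vertex last, so the values [seed0 k] and
   [false] are arbitrary. *)
pose g1 (s1 : seed k) (u : vertex k) := f (s1, seed0 k, false) (fst_copy u).
pose g2 (s1 s2 : seed k) (u : vertex k) := f (s1, s2, false) (snd_copy u).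
have fst_g s1 s2 b u : f (s1, s2, b) (fst_copy u) = g1 s1 u.
  apply: cf => -[[x|x]|] [[y|y]|] //=; have := rank_lt u; lia.
have snd_g s1 s2 b u : f (s1, s2, b) (snd_copy u) = g2 s1 s2 u.
  apply: cf => -[[x|x]|] [[y|y]|] //=; have := rank_lt u; lia.
have /IH I1 : causal g1.
  move=> s s' v e; apply: cf => -[[x|x]|] [[y|y]|] //=.
  exact: e.
have I2 s1 : causal (g2 s1).
  move=> s s' v e; apply: cf => -[[x|x]|] [[y|y]|] //=.
  by rewrite !leq_add2l; apply: e.
have {}I1 := I1 (fun s x y e => pf (s, seed0 k, false) (fst_copy x) (fst_copy y) e).
have {}I2 s1 := IH _ (I2 s1) (fun s x y e => pf (s1, s, false) (snd_copy x) (snd_copy y) e).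
have step s1 s2 :
  (root_colors g1 s1 + 3 * root_colors (g2 s1) s2 + 1 <=
   2 * (root_colors f (s1, s2, false) + root_colors f (s1, s2, true)))%N.
  rewrite /root_colors /= map_cat -!map_comp.
  rewrite (eq_map (fst_g s1 s2 false)) !(eq_map (snd_g s1 s2 _)).
  (* Here [x] is the color of the new vertex when it is joined: properness keeps it off the root
     colors of the first copy. *)
  apply: ndistinct_coin; apply/mapP => -[v v1].
  rewrite -(fst_g s1 s2 true) => /eqP; apply/negP.
  by apply: pf => /=; rewrite v1.
have -> : (\sum_(s : seed k.+1) root_colors f s =
  \sum_s1 \sum_s2 (root_colors f (s1, s2, false) + root_colors f (s1, s2, true)))%N.
  rewrite pair_big /= [RHS](eq_bigr (fun p => \sum_(b : bool) root_colors f (p, b))%N).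
    by rewrite pair_big /=; apply: eq_bigr => -[[]].
  by move=> [s1 s2] _; rewrite big_bool addnC.
have : (\sum_s1 \sum_s2 (root_colors g1 s1 + 3 * root_colors (g2 s1) s2 + 1) <=
  \sum_s1 \sum_s2 2 * (root_colors f (s1, s2, false) + root_colors f (s1, s2, true)))%N.
  by apply: leq_sum => s1 _; apply: leq_sum => s2 _; apply: step.
have rowE s1 : (\sum_s2 (root_colors g1 s1 + 3 * root_colors (g2 s1) s2 + 1) =
    #|seed k| * root_colors g1 s1 + 3 * (\sum_s2 root_colors (g2 s1) s2) + #|seed k|)%N.
  by rewrite 2!big_split /= sum_nat_const sum1_card big_distrr.
rewrite (eq_bigr _ (fun s1 _ => rowE s1)) 2!big_split /= sum_nat_const.
rewrite -(big_distrr #|seed k|) -(big_distrr 3%N) /=.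
under [X in (_ <= X)%N]eq_bigr do rewrite -(big_distrr 2%N).
rewrite -(big_distrr 2%N) /=.
have : (#|seed k| * (#|seed k| * (k + 4)) <= 4 * \sum_s1 \sum_s2 root_colors (g2 s1) s2)%N.
  by rewrite -sum_nat_const big_distrr; apply: leq_sum => s1 _; apply: I2.
rewrite card_seedS.
move: I1; set a := (\sum_i _)%N; set b := (\sum_i _)%N; set c := (\sum_i _)%N.
set m := #|_|; nia.
Qed.

(** * Disks *)

(* The plain names [center] and [radius] are taken by MathComp-Analysis. *)
Local Notation center := Defs.center.
Local Notation radius := Defs.radius.

Section Geometry.
Variable R : realType.
Implicit Types (x y r : R).

Lemma disks_meet_dist (D E : disk R) : disk_set D `&` disk_set E !=set0 ->
  ((center D).1 - (center E).1) ^+ 2 + ((center D).2 - (center E).2) ^+ 2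
    <= (radius D + radius E) ^+ 2.
Proof.
case: D => -[a1 a2] r r0; case: E => -[b1 b2] s s0 [[p q]] [] /=.
rewrite /disk_set /= => hD hE.
set u1 := p - a1 in hD *; set u2 := q - a2 in hD *.
set v1 := p - b1 in hE *; set v2 := q - b2 in hE *.
have -> : a1 - b1 = v1 - u1 by rewrite /v1 /u1; ring.
have -> : a2 - b2 = v2 - u2 by rewrite /v2 /u2; ring.
suff : - (u1 * v1 + u2 * v2) <= r * s by nra.
apply: le_trans (ler_norm _) _.
rewrite -(@ler_pXn2r _ 2) ?nnegrE //; last by nra.
rewrite normrN real_normK ?num_real // exprMn.
have : (u1 ^+ 2 + u2 ^+ 2) * (v1 ^+ 2 + v2 ^+ 2) <= r ^+ 2 * s ^+ 2.
  by apply: ler_pM => //; rewrite addr_ge0 ?sqr_ge0.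
(* Cauchy-Schwarz, by Lagrange's identity. *)
have := sqr_ge0 (u1 * v2 - u2 * v1).
by nra.
Qed.

Lemma tangent_disks_meet (D E : disk R) :
  ((center D).1 - (center E).1) ^+ 2 + ((center D).2 - (center E).2) ^+ 2
    = (radius D + radius E) ^+ 2 ->
  disk_set D `&` disk_set E !=set0.
Proof.
case: D => -[a1 a2] r r0; case: E => -[b1 b2] s s0 /= e.
have rs : r + s != 0 by rewrite gt_eqF // addr_gt0.
(* The point of tangency, which divides the segment between the centers in the ratio [r : s]. *)
exists ((s * a1 + r * b1) / (r + s), (s * a2 + r * b2) / (r + s)).
split; rewrite /disk_set /=.
  have -> : (s * a1 + r * b1) / (r + s) - a1 = - (r / (r + s)) * (a1 - b1) by field.
  have -> : (s * a2 + r * b2) / (r + s) - a2 = - (r / (r + s)) * (a2 - b2) by field.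
  by rewrite !exprMn -mulrDr e sqrrN -exprMn divfK.
have -> : (s * a1 + r * b1) / (r + s) - b1 = (s / (r + s)) * (a1 - b1) by field.
have -> : (s * a2 + r * b2) / (r + s) - b2 = (s / (r + s)) * (a2 - b2) by field.
by rewrite !(exprMn _ (s / _)) -mulrDr e -exprMn divfK.
Qed.

(** Inclusion passes to bounding boxes, by looking at the four extreme points of [D]. Applied both
    ways, it recovers the center from the set, as injectivity in [realizes] requires. *)
Lemma disk_set_sub (D E : disk R) : disk_set D `<=` disk_set E ->
  [/\ (center D).1 + radius D <= (center E).1 + radius E,
      (center E).1 - radius E <= (center D).1 - radius D,
      (center D).2 + radius D <= (center E).2 + radius E &
      (center E).2 - radius E <= (center D).2 - radius D].
Proof.
case: D => -[a1 a2] r r0; case: E => -[b1 b2] s s0; rewrite /disk_set => sub /=.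
have far (t u : R) : t ^+ 2 + u ^+ 2 <= s ^+ 2 -> `|t| <= s /\ `|u| <= s.
  have t2 := sqr_ge0 t; have u2 := sqr_ge0 u => h.
  have s0' := ltW s0.
  by split; rewrite -(@ler_pXn2r _ 2) ?nnegrE // real_normK ?num_real //; lra.
have {}sub p q : (p - a1) ^+ 2 + (q - a2) ^+ 2 <= r ^+ 2 ->
    `|p - b1| <= s /\ `|q - b2| <= s.
  by move=> h; apply: far; apply: (sub (p, q)).
have [] := sub (a1 + r) a2; first by nra.
have [] := sub (a1 - r) a2; first by nra.
have [] := sub a1 (a2 + r); first by nra.
have [] := sub a1 (a2 - r); first by nra.
rewrite !ler_norml => _ /andP [? ?] _ /andP [? ?] /andP [? ?] _ /andP [? ?] _.
by split; lra.
Qed.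

Lemma disk_set_eq (D E : disk R) : disk_set D = disk_set E -> center D = center E.
Proof.
move=> e; have [] := @disk_set_sub D E; first by rewrite e.
have [] := @disk_set_sub E D; first by rewrite e.
case: D E {e} => -[a1 a2] r ? [[b1 b2] s ?] /= ? ? ? ? ? ? ? ?.
by congr (_, _); lra.
Qed.

Lemma strips_apart x x' y y' r r' : 0 < r -> 0 < r' -> r + r' < `|x - x'| ->
  (r + r') ^+ 2 < (x - x') ^+ 2 + (y - y') ^+ 2.
Proof.
move=> r0 r'0 h; rewrite ltr_wpDr ?sqr_ge0 //.
by rewrite -(real_normK (num_real (x - x'))) ltr_pXn2r // ?nnegrE // addr_ge0 // ltW.
Qed.

(** Why 4: if [w] is the half-width of the copies, they span [[x0 - 4w, x0 - 2w]] and
    [[x0 + 2w, x0 + 4w]], and the gap between them holds a disk of radius [w] with room to spare. *)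
Definition half_width (k : nat) : R := 4 ^+ k.

Lemma half_width_ge1 k : 1 <= half_width k.
Proof. by rewrite exprn_ege1 // ler1n. Qed.

Lemma half_widthS k : half_width k.+1 = 4 * half_width k.
Proof. exact: exprS. Qed.

Fixpoint vradius (k : nat) : vertex k -> R :=
  match k with
  | 0 => fun _ => 1
  | k'.+1 => fun u : option (vertex k' + vertex k') =>
      match u with
      | fst_copy u' => vradius u'
      | snd_copy u' => vradius u'
      | None => half_width k'
      end
  end.

(* A gadget centered at [x0] has its copies centered at [x0 -+ 3 * half_width k];
   the new disk lies above the first copy if it joins it, and otherwise in the
   gap between the two. *)
Definition new_x (k : nat) (b : bool) x0 : R :=
  if b then x0 - 3 * half_width k else x0.

Fixpoint xpos (k : nat) : seed k -> R -> vertex k -> R :=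
  match k with
  | 0 => fun _ x0 _ => x0
  | k'.+1 => fun (s : seed k' * seed k' * bool) x0 (u : option (vertex k' + vertex k')) =>
      let: (s1, s2, b) := s in
      match u with
      | fst_copy u' => xpos s1 (x0 - 3 * half_width k') u'
      | snd_copy u' => xpos s2 (x0 + 3 * half_width k') u'
      | None => new_x k' b x0
      end
  end.

(* The height at which a disk of radius [r'] centered on the abscissa [x'] touches
   from below the disk of center [(x, y)] and radius [r]. *)
Definition hang x y r : R -> R -> R :=
  fun x' r' => y - Num.sqrt ((r + r') ^+ 2 - (x' - x) ^+ 2).

(* [Y x r] prescribes the height of the center of a root of abscissa [x] and
   radius [r]: it is where the gadget attaches to its parent, if any. *)
Fixpoint ypos (k : nat) : seed k -> R -> (R -> R -> R) -> vertex k -> R :=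
  match k with
  | 0 => fun _ x0 Y _ => Y x0 1
  | k'.+1 => fun (s : seed k' * seed k' * bool) x0 Y (u : option (vertex k' + vertex k')) =>
      let: (s1, s2, b) := s in
      let x := new_x k' b x0 in
      let y := Y x (half_width k') in
      match u with
      | fst_copy u' =>
          ypos s1 (x0 - 3 * half_width k') (if b then hang x y (half_width k') else Y) u'
      | snd_copy u' => ypos s2 (x0 + 3 * half_width k') Y u'
      | None => y
      end
  end.

Lemma vradius_bounds k (u : vertex k) : 1 <= vradius u <= half_width k.
Proof.
elim: k u => [|k IH] /=; first by rewrite /half_width expr0 lexx.
have h1 := half_width_ge1 k; have hS := half_widthS k.
by move=> [[u|u]|]; first [have := IH u | idtac]; lra.
Qed.

Lemma stripE x x' r r' :
  (`|x - x'| + r <= r') = (x' - r' <= x - r) && (x + r <= x' + r').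
Proof. by rewrite -lerBrDr ler_norml; apply/andP/andP => -[? ?]; split; lra. Qed.

Lemma xpos_strip k (s : seed k) x0 u :
  `|xpos s x0 u - x0| + vradius u <= half_width k.
Proof.
rewrite stripE; elim: k s x0 u => [|k IH] /=.
  by move=> *; rewrite /half_width expr0 !lexx.
have h1 := half_width_ge1 k; have hS := half_widthS k.
move=> [[s1 s2] b] x0 [[u|u]|].
- by have := IH s1 (x0 - 3 * half_width k) u; lra.
- by have := IH s2 (x0 + 3 * half_width k) u; lra.
- by rewrite /new_x; case: b; lra.
Qed.

Lemma ypos_root k (s : seed k) x0 Y u : u \in forest_roots s ->
  ypos s x0 Y u = Y (xpos s x0 u) (vradius u).
Proof.
elim: k s x0 Y u => [|k IH] // [[s1 s2] b] x0 Y [[u|u]|] //.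
- by rewrite forest_roots_fst /= => /andP [/negbTE -> /IH ->].
- by rewrite forest_roots_snd /= => /IH ->.
Qed.

(** The squared depth of the hanging center is at least [(r + r')^2 - (r - r')^2 = 4 r r'], hence at
    least [r'^2]. *)
Lemma hang_below x y r x' r' : 0 < r -> 0 < r' -> `|x' - x| + r' <= r ->
  hang x y r x' r' + r' <= y.
Proof.
move=> r0 r'0 h; rewrite /hang.
suff : r' <= Num.sqrt ((r + r') ^+ 2 - (x' - x) ^+ 2) by lra.
rewrite -(@ler_pXn2r _ 2) ?nnegrE ?sqrtr_ge0 //; last by lra.
have n0 := normr_ge0 (x' - x).
rewrite -(real_normK (num_real (x' - x))) sqr_sqrtr; nra.
Qed.

(** The invariant that shields a parent from its deeper descendants: each disk lies in the vertical
    shadow of some root and, unless it is that root, below the root's center. *)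
Lemma below_root k (s : seed k) x0 Y u : exists2 a, a \in forest_roots s &
  `|xpos s x0 u - xpos s x0 a| + vradius u <= vradius a /\
  (u = a \/ ypos s x0 Y u + vradius u <= ypos s x0 Y a).
Proof.
elim: k s x0 Y u => [|k IH].
  by move=> s x0 Y []; exists tt => //; rewrite subrr normr0 add0r; split => //; left.
move=> [[s1 s2] b] x0 Y; have h1 := half_width_ge1 k.
have self (u : vertex k.+1) :
    `|@xpos k.+1 (s1, s2, b) x0 u - @xpos k.+1 (s1, s2, b) x0 u| + vradius u <= vradius u.
  by rewrite subrr normr0 add0r.
move=> [[u|u]|]; last by exists None => //; split; [exact: self | left].
- case: b self => self.
    exists None => //=; split; first exact: xpos_strip.
    right; have [a ar [strip low]] := IH s1 (x0 - 3 * half_width k)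
      (hang (x0 - 3 * half_width k) (Y (x0 - 3 * half_width k) (half_width k)) (half_width k)) u.
    have /andP [a1 _] := vradius_bounds a.
    have := @hang_below (x0 - 3 * half_width k) (Y (x0 - 3 * half_width k) (half_width k))
      (half_width k) (xpos s1 (x0 - 3 * half_width k) a) (vradius a).
    rewrite -(ypos_root _ _ ar) => /(_ _ _ (xpos_strip s1 _ a)).
    have /andP [u1 _] := vradius_bounds u.
    by case: low => [->|low] hb; have := hb ltac:(lra) ltac:(lra); lra.
  have [a ar [strip low]] := IH s1 (x0 - 3 * half_width k) Y u.
  exists (fst_copy a); first by rewrite forest_roots_fst.
  by split => //=; case: low => [->|]; [left | right].
- have [a ar [strip low]] := IH s2 (x0 + 3 * half_width k) Y u.
  exists (snd_copy a); first by rewrite forest_roots_snd.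
  by split => //=; case: low => [->|]; [left | right].
Qed.

Lemma hang_tangent x y r x' r' : 0 < r -> 0 < r' -> `|x' - x| + r' <= r ->
  (x - x') ^+ 2 + (y - hang x y r x' r') ^+ 2 = (r + r') ^+ 2.
Proof.
move=> r0 r'0 h; rewrite /hang subKr sqr_sqrtr.
  by ring.
have n0 := normr_ge0 (x' - x).
by rewrite -(real_normK (num_real (x' - x))); nra.
Qed.

Lemma hang_apart x y r xa ra xu yu ru :
  0 < r -> 0 < ra -> 0 < ru -> `|xa - x| + ra <= r ->
  `|xu - xa| + ru <= ra -> yu + ru <= hang x y r xa ra ->
  (r + ru) ^+ 2 < (x - xu) ^+ 2 + (y - yu) ^+ 2.
Proof.
move=> r0 ra0 ru0 ha hu; rewrite /hang; set q := Num.sqrt _ => low.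
have n0 := normr_ge0 (xa - x); have m0 := normr_ge0 (xu - xa).
have q2 : q ^+ 2 = (r + ra) ^+ 2 - `|xa - x| ^+ 2.
  by rewrite real_normK ?num_real // sqr_sqrtr // -(real_normK (num_real (xa - x))); nra.
have q0 : 0 <= q by apply: sqrtr_ge0.
have dy : (ru + q) ^+ 2 <= (y - yu) ^+ 2 by nra.
(* For [|xa - x| <= ra - ru] the left side is nonpositive; otherwise it is at most the square of
   [|xa - x| - (ra - ru)], a lower bound for [|x - xu|]. *)
have dx : `|xa - x| ^+ 2 - 2 * `|xa - x| * (ra - ru) <= (x - xu) ^+ 2.
  have tri : `|xa - x| <= `|x - xu| + `|xu - xa|.
    by rewrite (distrC xa x); apply: ler_distD.
  rewrite -(real_normK (num_real (x - xu))).
  have p0 := normr_ge0 (x - xu).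
  by have [?|?] := lerP `|xa - x| (ra - ru); nra.
(* By [dx] and [dy], the squared distance exceeds [(r + ru)^2] by at least [ra^2 + 2 ru q + 2 (r -
   |xa - x|) (ra - ru)]. *)
have p1 : 0 <= (r - `|xa - x|) * (ra - ru) by apply: mulr_ge0; lra.
have p2 : 0 <= ru * q by apply: mulr_ge0; lra.
have p3 : 0 < ra ^+ 2 by rewrite exprn_gt0.
nra.
Qed.

(* A child is tangent to its parent, so no two centers coincide. *)
Lemma layout k (s : seed k) x0 Y u v : u != v ->
  let d := (xpos s x0 u - xpos s x0 v) ^+ 2 + (ypos s x0 Y u - ypos s x0 Y v) ^+ 2 in
  if adj s u v then d = (vradius u + vradius v) ^+ 2 else (vradius u + vradius v) ^+ 2 < d.
Proof.
elim: k s x0 Y u v => [|k IH] s x0 Y; first by case=> -[].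
case: s => -[s1 s2] b; have h1 := half_width_ge1 k.
have rad0 j (w : vertex j) : 0 < vradius w by have := vradius_bounds w; lra.
have new_fst w :
  let d := (@xpos k.+1 (s1, s2, b) x0 None - @xpos k.+1 (s1, s2, b) x0 (fst_copy w)) ^+ 2 +
           (@ypos k.+1 (s1, s2, b) x0 Y None - @ypos k.+1 (s1, s2, b) x0 Y (fst_copy w)) ^+ 2 in
  if @adj k.+1 (s1, s2, b) None (fst_copy w)
  then d = (half_width k + vradius w) ^+ 2 else (half_width k + vradius w) ^+ 2 < d.
  rewrite /=; case: b => /=.
    (* Roots of the first copy touch the new disk; any other vertex lies below the center of a root
       [a], where [hang_apart] applies. *)
    have := below_root s1 (x0 - 3 * half_width k)
      (hang (x0 - 3 * half_width k) (Y (x0 - 3 * half_width k) (half_width k)) (half_width k)) w.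
    move=> [a ar [strip low]]; case: ifP => wr.
      by rewrite (ypos_root _ _ wr); apply: hang_tangent => //; [lra | exact: xpos_strip].
    case: low => [e|low]; first by rewrite e ar in wr.
    rewrite (ypos_root _ _ ar) in low.
    by apply: (hang_apart _ _ _ (xpos_strip s1 _ a) strip low) => //; lra.
  apply: strips_apart => //; first by lra.
  apply: lt_le_trans (ler_norm _).
  by have := xpos_strip s1 (x0 - 3 * half_width k) w; rewrite stripE; lra.
have new_snd w :
  (half_width k + vradius w) ^+ 2 <
    (@xpos k.+1 (s1, s2, b) x0 None - @xpos k.+1 (s1, s2, b) x0 (snd_copy w)) ^+ 2 +
    (@ypos k.+1 (s1, s2, b) x0 Y None - @ypos k.+1 (s1, s2, b) x0 Y (snd_copy w)) ^+ 2.
  apply: strips_apart => //=; first by lra.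
  rewrite distrC; apply: lt_le_trans (ler_norm _).
  have := xpos_strip s2 (x0 + 3 * half_width k) w; rewrite stripE.
  by rewrite /new_x; case: (b); lra.
have fst_snd w w' :
  (vradius w + vradius w') ^+ 2 <
    (@xpos k.+1 (s1, s2, b) x0 (fst_copy w) - @xpos k.+1 (s1, s2, b) x0 (snd_copy w')) ^+ 2 +
    (@ypos k.+1 (s1, s2, b) x0 Y (fst_copy w) - @ypos k.+1 (s1, s2, b) x0 Y (snd_copy w')) ^+ 2.
  apply: strips_apart => //=.
  rewrite distrC; apply: lt_le_trans (ler_norm _).
  have := xpos_strip s2 (x0 + 3 * half_width k) w'; rewrite stripE.
  by have := xpos_strip s1 (x0 - 3 * half_width k) w; rewrite stripE; lra.
move=> [[u|u]|] [[v|v]|] // uv /=.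
- by apply: IH; apply: contraNneq uv => ->.
- exact: fst_snd.
- by rewrite (addrC (vradius u)) -sqrrN opprB
    -(sqrrN (ypos _ _ _ _ - _)) opprB; apply: new_fst.
- by rewrite (addrC (vradius u)) -(sqrrN (xpos _ _ _ - _)) opprB
    -(sqrrN (ypos _ _ _ _ - _)) opprB; apply: fst_snd.
- by apply: IH; apply: contraNneq uv => ->.
- by rewrite (addrC (vradius u)) -(sqrrN (xpos _ _ _ - _)) opprB
    -(sqrrN (ypos _ _ _ _ - _)) opprB; apply: new_snd.
- exact: new_fst.
- exact: new_snd.
Qed.

End Geometry.

(** * From layouts to disk graphs; chromatic number; measurability *)

Lemma realizes_layout (R : realType) (n : nat) (D : 'I_n -> disk R) (G : rel 'I_n) :
  irreflexive G ->
  (forall i j, i != j ->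
     let d := ((center (D i)).1 - (center (D j)).1) ^+ 2 +
              ((center (D i)).2 - (center (D j)).2) ^+ 2 in
     if G i j then d = (radius (D i) + radius (D j)) ^+ 2
     else (radius (D i) + radius (D j)) ^+ 2 < d) ->
  realizes D G.
Proof.
move=> irrG lay; split=> [i j /disk_set_eq eqc|i j].
  (* Equal centers would give [d = 0], which neither tangency nor separation allows. *)
  apply/eqP; apply/negPn/negP => /lay /=; rewrite eqc !subrr expr0n /= addr0.
  have : 0 < (radius (D i) + radius (D j)) ^+ 2 by rewrite exprn_gt0 // addr_gt0 // radius_gt0.
  by case: ifP => _ h e; move: h; rewrite -?e ?ltxx // => /lt_trans /(_ e); rewrite ltxx.
split=> [Gij|[/eqP neq meet]].
  have neq : i != j by apply: contraTneq Gij => ->; rewrite irrG.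
  split; first exact/eqP.
  by apply: tangent_disks_meet; have := lay _ _ neq; rewrite Gij.
have /= := lay _ _ neq; case: (G i j) => //.
by move=> /lt_le_trans /(_ (disks_meet_dist meet)); rewrite ltxx.
Qed.

Lemma chromatic_number_eq2 (T : finType) (G : rel T) (f : T -> bool) x y :
  G x y -> proper_coloring G f -> chromatic_number G = 2.
Proof.
move=> Gxy pf.
have colorableS k : (2 <= k)%N -> colorable G k.
  case: k => // k k2; apply/asboolP; exists (fun z => inord (f z)) => u v /pf.
  apply: contra => /eqP /(congr1 val) /=.
  by rewrite !inordK; case: (f u) (f v) => [] [] //; lia.
(* This makes the default [#|T|] of the minimum admissible and puts 2 among the candidates. *)
have T2 : (2 <= #|T|)%N.
  rewrite ltnNge; apply/negP => /card_le1_eqP /(_ x y isT isT) exy.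
  by move: (pf _ _ Gxy); rewrite exy eqxx.
rewrite /chromatic_number; case: arg_minnP => [|i /asboolP [g pg] imin].
  exact: colorableS.
apply/eqP; rewrite eqn_leq; apply/andP; split.
  have lt2 : (2 < #|T|.+1)%N by [].
  by have /= -> := imin (Ordinal lt2) (colorableS 2 isT).
rewrite ltnNge; apply/negP => i1; move/negP: (pg _ _ Gxy); apply.
have small z : g z = 0%N :> nat by have := leq_trans (ltn_ord (g z)) i1; case: (nat_of_ord _).
by apply/eqP/val_inj; rewrite /= !small.
Qed.

(** No condition on [g] is imposed: [f] takes countably many values, and each of its fibers is a
    finite intersection of measurable sets. *)
Lemma measurable_fun_finite_family (R : realType) (d : measure_display)
    (T : measurableType d) (n : nat) (f : T -> 'I_n -> nat) (g : ('I_n -> nat) -> R) :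
  (forall i, measurable_fun [set: T] (fun w => f w i)) ->
  measurable_fun [set: T] (fun w => g (f w)).
Proof.
move=> mf _ Y _; rewrite setTI.
have -> : (fun w => g (f w)) @^-1` Y =
  \bigcup_(t : {ffun 'I_n -> nat})
    (if `[< Y (g t) >] then \bigcap_i [set w | f w i = t i] else set0).
  apply/seteqP; split => [w Yw|w [t _]].
    exists (finfun (f w)) => //.
    have e : finfun (f w) = f w :> ('I_n -> nat) by apply/funext => i; rewrite ffunE.
    by rewrite e asboolT // => i _ /=; rewrite e.
  case: asboolP => // Yt ft; rewrite /preimage /=.
  by have -> : f w = t by apply/funext => i; apply: ft.
apply: countable_bigcupT_measurable => [|t]; first exact: countableP.
case: ifP => // _; apply: fin_bigcap_measurable => // i _.
by have := mf i measurableT [set t i] I; rewrite setTI; exact.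
Qed.

(** * Padding to [n] vertices and ratio [rho] *)

Section Host.
Variables n k : nat.

Definition decode (i : nat) : vertex k + nat :=
  if (i < num_vertices k)%N then inl (unrank k i) else inr (i - num_vertices k)%N.

(* The first two padding vertices form an edge, which makes the chromatic number
   2 even when the forest has no edge; the first also gets the radius [rho]. *)
Definition pad_adj (i j : nat) : bool :=
  (i == 0) && (j == 1%N) || (i == 1%N) && (j == 0).

Definition host_adj (s : seed k) (u v : vertex k + nat) : bool :=
  match u, v with
  | inl u', inl v' => adj s u' v'
  | inr i, inr j => pad_adj i j
  | _, _ => false
  end.

Definition host (s : seed k) : rel 'I_n :=
  fun i j => host_adj s (decode i) (decode j).

Lemma decode_inj : injective decode.
Proof.
move=> i j; rewrite /decode; case: ifP => hi; case: ifP => hj // [].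
  by move=> /(congr1 (@rank k)); rewrite !unrankK.
by move: hi hj; lia.
Qed.

Lemma host_irr s : irreflexive (host s).
Proof.
move=> i; rewrite /host /host_adj; case: decode => [u|j]; first exact: adj_irr.
by rewrite /pad_adj; lia.
Qed.

Section HostColoring.
Hypothesis room : (num_vertices k + 2 <= n)%N.

Lemma big_pad_lt : (num_vertices k < n)%N. Proof. by move: room; lia. Qed.
Lemma small_pad_lt : (num_vertices k + 1 < n)%N. Proof. by move: room; lia. Qed.

Lemma decode_pad j : decode (num_vertices k + j) = inr j.
Proof. by rewrite /decode ltnNge leq_addr /= addKn. Qed.

Lemma host_chromatic s : chromatic_number (host s) = 2%N.
Proof.
pose f (i : 'I_n) := if decode i is inl u then side s u else decode i == inr 0%N.
apply: (@chromatic_number_eq2 _ _ f (Ordinal big_pad_lt) (Ordinal small_pad_lt)).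
  by rewrite /host /= -{1}(addn0 (num_vertices k)) !decode_pad.
move=> i j; rewrite /host /f /host_adj.
case: (decode i) (decode j) => [u|a] [v|b] //; first exact: side_adj.
by rewrite /pad_adj => /orP [] /andP [/eqP -> /eqP ->].
Qed.

Definition host_vertex (v : vertex k) : 'I_n :=
  Ordinal (ltn_trans (rank_lt v) big_pad_lt).

Lemma decode_host_vertex v : decode (host_vertex v) = inl v.
Proof. by rewrite /decode /= rank_lt rankK. Qed.

End HostColoring.

Section HostDisks.
Variables (R : realType) (rho : R).
Hypothesis wide : half_width R k <= rho.

Definition host_radius (u : vertex k + nat) : R :=
  match u with
  | inl u' => vradius R u'
  | inr 0 => rho
  | inr _ => 1
  end.

(** The big padding disk sits at distance 1 to the left of the forest's strip, with the second one
    tangent to it on the far side; the remaining unit disks go to the right, 3 apart. *)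
Definition host_x (s : seed k) (u : vertex k + nat) : R :=
  match u with
  | inl u' => xpos s 0 u'
  | inr 0 => - (half_width R k + rho + 1)
  | inr 1 => - (half_width R k + 2 * rho + 2)
  | inr j => half_width R k + 3 * j%:R
  end.

Definition host_y (s : seed k) (u : vertex k + nat) : R :=
  if u is inl u' then ypos s 0 (fun _ _ => 0) u' else 0.

Lemma host_radius_bounds u : 1 <= host_radius u <= rho.
Proof.
have h1 := half_width_ge1 R k; have h2 := wide.
by case: u => [u|[|j]] /=; [have := vradius_bounds R u; lra | lra | lra].
Qed.

Lemma host_layout s u v : u != v ->
  let d := (host_x s u - host_x s v) ^+ 2 + (host_y s u - host_y s v) ^+ 2 in
  if host_adj s u v then d = (host_radius u + host_radius v) ^+ 2
  else (host_radius u + host_radius v) ^+ 2 < d.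
Proof.
have h1 := half_width_ge1 R k; have h2 := wide.
have host_radius0 w : 0 < host_radius w by have := host_radius_bounds w; lra.
have tree_pad t j : host_radius (inl t) + host_radius (inr j) <
    `|host_x s (inl t) - host_x s (inr j)|.
  have := xpos_strip s (0 : R) t; rewrite stripE /=; case: j => [|[|j]] /= strip.
  - by apply: lt_le_trans (ler_norm _); lra.
  - by apply: lt_le_trans (ler_norm _); lra.
  - have j0 : 0 <= j%:R :> R by [].
    by rewrite distrC; apply: lt_le_trans (ler_norm _); rewrite -(addn2 j) natrD; lra.
have pad_pad i j : (i < j)%N -> pad_adj i j = false ->
    host_radius (inr i) + host_radius (inr j) < `|host_x s (inr i) - host_x s (inr j)|.
  case: j i => [|[|j]] [|[|i]] //= ij _; rewrite distrC;
    apply: lt_le_trans (ler_norm _).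
  - have j0 : 0 <= j%:R :> R by [].
    by rewrite -(addn2 j) natrD; lra.
  - have j0 : 0 <= j%:R :> R by [].
    by rewrite -(addn2 j) natrD; lra.
  - have : i.+1%:R <= j%:R :> R by rewrite ler_nat; lia.
    by rewrite -(addn2 j) -(addn2 i) !natrD -natr1; lra.
case: u v => [u|i] [v|j] uv.
- by apply: layout; apply: contraNneq uv => ->.
- by apply: strips_apart => //; apply: tree_pad.
- by apply: strips_apart => //; rewrite addrC distrC; apply: tree_pad.
- have {}uv : i != j by apply: contraNneq uv => ->.
  rewrite /host_adj; case: ifP => [/orP [] /andP [/eqP -> /eqP ->] /=|ij]; [ring|ring|].
  case: ltngtP uv => // lt_ij _.
    by apply: strips_apart => //; apply: pad_pad.
  apply: strips_apart => //; rewrite addrC distrC; apply: pad_pad => //.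
  by move: ij; rewrite /pad_adj; lia.
Qed.

Lemma host_radius_gt0 u : 0 < host_radius u.
Proof. by have := host_radius_bounds u; lra. Qed.

Definition host_disk (s : seed k) (i : 'I_n) : disk R :=
  Disk (host_x s (decode i), host_y s (decode i)) (host_radius_gt0 (decode i)).

Lemma host_realizes s : realizes (host_disk s) (host s).
Proof.
apply: realizes_layout; first exact: host_irr.
move=> i j ij; apply: host_layout; apply: contraNneq ij => /decode_inj e.
exact/eqP/val_inj.
Qed.

Lemma host_ratio (room : (num_vertices k + 2 <= n)%N) s : radius_ratio (host_disk s) rho.
Proof.
exists (Ordinal (big_pad_lt room)), (Ordinal (small_pad_lt room)).
rewrite /= decode_pad -(addn0 (num_vertices k)) decode_pad /= divr1; split => // i.
exact: host_radius_bounds.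
Qed.

(** The forest is presented before the padding, so what is revealed while it is being colored
    depends on the seed only through the forest; colors used elsewhere can only add to the count. *)
Lemma host_sum_colors (room : (num_vertices k + 2 <= n)%N) (B : strategy) :
  online_coloring R B ->
  (#|seed k| * (k + 4) <= 4 * \sum_s num_colors (run B (host s)))%N.
Proof.
move=> onB; pose f s v := run B (host s) (host_vertex room v).
apply: leq_trans (@sum_root_colors k f _ _) _.
- move=> s s' v agree; rewrite /f /run; congr (B _ _).
  apply/funext => a; apply/funext => b; rewrite /revealed /= /host /host_adj.
  have lt_a : (a < num_vertices k)%N by rewrite (leq_trans (ltn_ord a)) // rank_lt.
  have lt_b : (b < num_vertices k)%N by rewrite (leq_trans (ltn_ord b)) // rank_lt.
  rewrite /decode /= lt_a lt_b; apply: agree; rewrite unrankK //.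
    by have := ltn_ord a.
  by have := ltn_ord b.
- move=> s u v uv; apply: (onB n (host s)).
    by exists (host_disk s); apply: host_realizes.
  by rewrite /host !decode_host_vertex.
- rewrite leq_mul2l /=; apply: leq_sum => s _.
  apply: ndistinct_subset => c /mapP [v _ ->].
  exact: codom_f.
Qed.

End HostDisks.

End Host.

(** * Expected number of colors *)

(** The averaging step of Yao's principle: were all expectations below [e], they would be finite
    with sum below [#|S| * e], against linearity. *)
Lemma expectation_ge_of_sum (R : realType) (d : measure_display) (T : measurableType d)
    (P : probability T R) (S : finType) (X : S -> T -> R) (e : R) :
  (forall s, measurable_fun [set: T] (X s)) -> (forall s w, 0 <= X s w) ->
  (0 < #|S|)%N -> (forall w, #|S|%:R * e <= \sum_s X s w) ->
  exists s, (e%:E <= 'E_P[X s])%E.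
Proof.
move=> mX X0 /card_gt0P [s0 _] le_sum; apply: contrapT => /forallNP none.
have small s : ('E_P[X s] < e%:E)%E by rewrite ltNge; apply/negP/none.
have fin s : ('E_P[X s] = (fine 'E_P[X s])%:E)%E.
  rewrite fineK // ge0_fin_numE ?expectation_ge0 //.
  exact: lt_trans (small s) (ltry _).
have sumE : ('E_P[fun w => (\sum_s X s w)%R] = \sum_s 'E_P[X s])%E.
  rewrite unlock; under eq_integral do rewrite -sumEFin.
  rewrite ge0_integral_sum //; last by move=> s w _; rewrite lee_fin.
  by move=> s; apply/measurable_EFinP.
have : ((#|S|%:R * e)%:E <= 'E_P[fun w => (\sum_s X s w)%R])%E.
  rewrite -(expectation_cst P (#|S|%:R * e)).
  (* Monotonicity of expectation is applied to nonnegative functions; for negative [e] the bound is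
     trivial. *)
  have [e0|e0] := lerP 0 e.
    apply: expectation_le => //.
    - exact: measurable_sum.
    - by move=> w; rewrite mulr_ge0.
    - by move=> w; apply: sumr_ge0.
    - exact: aeW.
  apply: le_trans (expectation_ge0 _ _); last by move=> w; apply: sumr_ge0.
  by rewrite expectation_cst lee_fin mulr_ge0_le0 // ltW.
rewrite sumE (eq_bigr _ (fun s _ => fin s)) sumEFin lee_fin leNgt => /negP; apply.
have -> : #|S|%:R * e = \sum_(s : S) e by rewrite sumr_const mulr_natl.
apply: ltr_sum => [|s _]; first by apply/hasP; exists s0; rewrite ?mem_index_enum.
by rewrite -lte_fin -fin.
Qed.

(** The seed is chosen before [w], as an oblivious adversary must do. *)
Lemma host_expected_colors (R : realType) (d : measure_display) (T : measurableType d)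
    (P : probability T R) (A : T -> strategy) (n k : nat) (rho : R) :
  randomized_online_coloring R A ->
  (num_vertices k + 2 <= n)%N -> half_width R k <= rho ->
  exists s : seed k,
    (((k + 4)%:R / 4)%:E <= 'E_P[fun w => (num_colors (run (A w) (@host n k s)))%:R])%E.
Proof.
move=> [onA mA] room wide.
apply: (@expectation_ge_of_sum _ _ _ P (seed k)
  (fun s w => (num_colors (run (A w) (@host n k s)))%:R)) => //.
- move=> s; apply: (@measurable_fun_finite_family _ _ _ _
    (fun w => run (A w) (@host n k s)) (fun f => (num_colors f)%:R)) => i.
  exact: mA.
- by apply/card_gt0P; exists (seed0 k).
move=> w; have := host_sum_colors wide room (onA w).
rewrite -(ler_nat R) !natrM natr_sum; lra.
Qed.

(** Take the largest [k] with [4^k <= min(n, rho)]. The threshold 25 forces [k >= 2], and then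
    [num_vertices k + 2 = 2^(k+1) + 1 <= 4^k <= n]. *)
Lemma gadget_level (R : realType) (n : nat) (rho : R) : 25 <= Num.min n%:R rho ->
  exists k, [/\ (num_vertices k + 2 <= n)%N, half_width R k <= rho &
    8^-1 * Num.min (ln n%:R) (ln rho) <= (k + 4)%:R / 4].
Proof.
rewrite le_min ler_nat => /andP [n25 rho25].
have rho0 : 0 <= rho by lra.
set m := minn n (Num.truncn rho).
have m25 : (25 <= m)%N by rewrite leq_min n25 truncn_ge_nat.
have m0 : (0 < m)%N by lia.
have /andP [] := @trunc_log_bounds 4 m isT m0; set k := trunc_log 4 m => lo hi.
have le4 : (4 ^ k = 2 ^ k * 2 ^ k)%N by rewrite -expnMn.
exists k; split.
- have k2 : (2 <= k)%N.
    by rewrite ltnNge; apply/negP => k1; move: hi; case: (k) k1 => [|[|]] //; lia.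
  have : (2 ^ 2 <= 2 ^ k)%N by rewrite leq_exp2l.
  have := num_verticesE k; rewrite expnS.
  by move: (leq_trans lo (geq_minl _ _)); rewrite le4; nia.
- rewrite /half_width -natrX (le_trans _ (_ : (Num.truncn rho)%:R <= rho)) ?truncn_le //.
  by rewrite ler_nat (leq_trans lo) // geq_minr.
(* From [ln 2 <= 1]; the smaller logarithm is thus at most [(k+1) ln 4 <= 2 (k+1)]. *)
- have ln4 : ln (4 : R) <= 2.
    have -> : (4 : R) = (1 + 1) ^+ 2 by ring.
    by rewrite lnXn //; have := @le_ln1Dx R 1; lra.
  have lnS x : 0 < x -> x < (4 ^ k.+1)%:R -> ln x <= 2 * k.+1%:R :> R.
    move=> x0 ltx; apply: (@le_trans _ _ (ln (4 ^+ k.+1))).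
      by rewrite ler_ln ?posrE ?exprn_gt0 // -natrX ltW.
    by rewrite lnXn // -(mulr_natr (ln _)) ler_wpM2r.
  have : Num.min (ln n%:R) (ln rho) <= 2 * k.+1%:R.
    move: hi; rewrite gtn_min ge_min => /orP [lt_n|lt_r].
      by rewrite lnS // ?ltr_nat // ltr0n; lia.
    by rewrite (lnS rho) ?orbT //; [lra | rewrite -truncn_lt_nat].
  by rewrite natrD -natr1; lra.
Qed.

Theorem theorem3 (R : realType) :
  exists c : R, 0 < c /\
  forall (d : measure_display) (T : measurableType d) (P : probability T R)
         (A : T -> strategy),
    randomized_online_coloring R A ->
  forall (n : nat) (rho : R),
    25 <= Num.min n%:R rho ->
  exists (G : rel 'I_n) (D : 'I_n -> disk R),
    [/\ realizes D G,
        chromatic_number G = 2%N,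
        radius_ratio D rho &
        ((c * Num.min (ln n%:R) (ln rho))%:E
           <= 'E_P[fun w => (num_colors (run (A w) G))%:R])%E].
Proof.
(* The constant compares [(k+4)/4] expected colors with a logarithm of at most [2 (k+1)]. *)
exists 8^-1; split; first by lra.
move=> d T P A onA n rho /gadget_level [k [room wide bound]].
have [s many] := host_expected_colors P onA room wide.
exists (@host n k s), (host_disk wide s); split.
- exact: host_realizes.
- exact: (host_chromatic room).
- exact: host_ratio.
- by apply: le_trans many; rewrite lee_fin.
Qed.
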